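(* Let $\mathbb{K}\in\{\mathbb{R},\mathbb{C}\}$, let $H \in \mathbb{K}^{n\times n}$ be a nonsingular selfadjoint matrix and let $\Phi \in \mathbb{K}^{n\times n}$ be an $H$-selfadjoint involutory matrix whose negative eigenspace is hyperbolic. Then any $(H, H\Phi)$-unitary matrix $W \in \mathbb{K}^{n\times n}$ can be factorized (non-uniquely) as $$W=LX,$$ where $L \in \mathbb{K}^{n\times n}$ is $H$-unitary and $X \in \mathbb{K}^{n\times n}$ is $H$-normal $H$-neutral involutory.
   Context: For a matrix $A$ over $\mathbb{K}$, $A^\dagger$ denotes the conjugate transpose if $\mathbb{K}=\mathbb{C}$ and the transpose if $\mathbb{K}=\mathbb{R}$; $A$ is selfadjoint if $A^\dagger=A$. For a nonsingular selfadjoint $H\in\mathbb{K}^{n\times n}$ put $[x,y]_H=x^\dagger H y$ for $x,y\in\mathbb{K}^n$, and $A^{[H]}=H^{-1}A^\dagger H$ (the $H$-adjoint). A matrix $A\in\mathbb{K}^{n\times n}$ is $H$-selfadjoint if $A^{[H]}=A$, $H$-unitary if $A^{[H]}A=AA^{[H]}=I_n$, and $H$-normal if $AA^{[H]}=A^{[H]}A$. For congruent nonsingular selfadjoint $H_1,H_2\in\mathbb{K}^{n\times n}$, a matrix $W\in\mathbb{K}^{n\times n}$ is $(H_1,H_2)$-unitary if $W^\dagger H_1W=H_2$. In particular $W$ is $(H,H\Phi)$-unitary if and only if $W^{[H]}W=\Phi$. A matrix $X\in\mathbb{K}^{n\times n}$ is involutory if $X^2=I_n$; its negative eigenspace is $\{v\in\mathbb{K}^n: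 Xv=-v\}$. A subspace is hyperbolic if it is nondegenerate with respect to $[\cdot,\cdot]_H$ and the restriction of $[\cdot,\cdot]_H$ to it has signature zero (equally many positive and negative squares; the zero subspace qualifies). A subspace $\mathcal{N}$ is $H$-neutral if $[u,v]_H=0$ for all $u,v\in\mathcal{N}$. An involutory $X$ is $H$-neutral if its negative eigenspace is $H$-neutral or $\{0\}$. $X$ is $H$-normal $H$-neutral involutory if it is involutory, $H$-neutral and $H$-normal.
   Formalization: Non-uniqueness is asserted only for Φ ≠ I, since for Φ = I the factorization is unique (X = I, L = W); existence of the factorization is stated for every Φ. *)

(* Defs.v *)
From mathcomp Require Import all_boot all_order all_algebra.
From mathcomp Require Import complex reals.

Set Implicit Arguments.
Unset Strict Implicit.
Unset Printing Implicit Defensive.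

Import Order.TTheory GRing.Theory Num.Theory.
Local Open Scope ring_scope.

(* The pair (K, conj) is (R, identity) or (R[i], complex conjugation), so that
   [conj_transpose conj] is the transpose over R and the conjugate transpose
   over R[i]. *)
Inductive real_or_complex (R : realType) :
    forall K : numFieldType, (K -> K) -> Prop :=
  | over_real : @real_or_complex R R idfun
  | over_complex : @real_or_complex R R[i] Num.conj.

Definition involutory (K : numFieldType) (n : nat) (X : 'M[K]_n) : Prop :=
  X *m X = 1%:M.

Definition neg_eigenspace (K : numFieldType) (n : nat) (X : 'M[K]_n) :
    {vspace 'cV[K]_n} :=
  passmx.leigenspace (linfun (mulmx X)) (- 1).

Lemma mem_neg_eigenspace (K : numFieldType) (n : nat) (X : 'M[K]_n)
    (v : 'cV[K]_n) :
  v \in neg_eigenspace X <-> X *m v = - v.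
Proof.
rewrite memv_ker !lfunE /= scaleN1r opprK id_lfunE lfunE /= addr_eq0.
by split=> [/eqP|/eqP].
Qed.

Section IndefiniteInnerProduct.
Variables (K : numFieldType) (conj : K -> K).

Definition conj_transpose (m n : nat) (A : 'M[K]_(m, n)) : 'M[K]_(n, m) :=
  map_mx conj A^T.

Definition selfadjoint (n : nat) (A : 'M[K]_n) : Prop := conj_transpose A = A.

Section Form.
Variables (n : nat) (H : 'M[K]_n).

Definition hform (x y : 'cV[K]_n) : K := (conj_transpose x *m H *m y) 0 0.

Definition hadjoint (A : 'M[K]_n) : 'M[K]_n :=
  invmx H *m conj_transpose A *m H.

Definition hselfadjoint (A : 'M[K]_n) : Prop := hadjoint A = A.

Definition hunitary (A : 'M[K]_n) : Prop :=
  hadjoint A *m A = 1%:M /\ A *m hadjoint A = 1%:M.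

Definition hnormal (A : 'M[K]_n) : Prop := A *m hadjoint A = hadjoint A *m A.

Definition nondegenerate_on (U : {vspace 'cV[K]_n}) : Prop :=
  forall u, u \in U -> (forall v, v \in U -> hform u v = 0) -> u = 0.

(* On U the form reduces to p positive and q negative squares.  For selfadjoint
   H the values [u, u]_H are real, and the order of a [numFieldType] only
   relates a number to 0 when that number is real. *)
Definition has_inertia (U : {vspace 'cV[K]_n}) (p q : nat) : Prop :=
  exists b : (\dim U).-tuple 'cV[K]_n,
    [/\ basis_of U b,
        forall i j : 'I_(\dim U), i != j -> hform (tnth b i) (tnth b j) = 0,
        #|[set i : 'I_(\dim U) | 0 < hform (tnth b i) (tnth b i)]| = p
      & #|[set i : 'I_(\dim U) | hform (tnth b i) (tnth b i) < 0]| = q].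

Definition hyperbolic (U : {vspace 'cV[K]_n}) : Prop :=
  nondegenerate_on U /\ exists p : nat, has_inertia U p p.

Definition neutral_subspace (U : {vspace 'cV[K]_n}) : Prop :=
  forall u v, u \in U -> v \in U -> hform u v = 0.

Definition hneutral (X : 'M[K]_n) : Prop :=
  neutral_subspace (neg_eigenspace X) \/ neg_eigenspace X = 0%VS.

Definition hnormal_hneutral_involutory (X : 'M[K]_n) : Prop :=
  [/\ involutory X, hneutral X & hnormal X].

End Form.

(* The congruence of H1 and H2 is witnessed by W itself: it is nonsingular as
   soon as H2 is. *)
Definition unitary_between (n : nat) (H1 H2 W : 'M[K]_n) : Prop :=
  conj_transpose W *m H1 *m W = H2.

Definition hfactorization (n : nat) (H W L X : 'M[K]_n) : Prop :=
  [/\ W = L *m X, hunitary H L & hnormal_hneutral_involutory H X].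

End IndefiniteInnerProduct.

(* Main.v *)
Require Import Defs.
From mathcomp Require Import all_boot all_order all_algebra.
From mathcomp Require Import complex reals.
Import Order.TTheory GRing.Theory Num.Theory.
Local Open Scope ring_scope.

(** Write [A^*] for the H-adjoint of A.  On the hyperbolic negative eigenspace
    N of Phi choose an orthogonal basis and pair its positive vectors with its
    negative ones.  Exchanging the (rescaled) vectors of each pair, and
    vanishing on the orthogonal complement of N, gives a skew matrix S
    ([S^* = - S]) whose square is the projection onto N, so that
    [Phi = 1 - 2 S^2].  Then [X = 1 - S^2 + S] is an involution with
    [X^* = 1 - S^2 - S] and [X^* X = X X^* = Phi], hence [W X] is H-unitary
    because [W^* W = Phi].  Replacing S by [- S] gives the second
    factorization. *)

Set Implicit Arguments.
Unset Strict Implicit.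

(** * Pairing a finite set with its complement *)

Lemma half_set_involution (T : finType) (A : {set T}) :
  #|A| = #|~: A| ->
  exists2 s : T -> T, involutive s & forall x, (s x \in A) = (x \notin A).
Proof.
move=> cardA.
(* The default [y] is left free because the outer [nth] in [s (s x)] has default [s x], not [x]. *)
have swap (B C : {set T}) x : #|B| = #|C| -> x \in B ->
    nth x (enum C) (index x (enum B)) \in C /\
    forall y, nth y (enum B)
      (index (nth x (enum C) (index x (enum B))) (enum C)) = x.
  move=> cardBC xB.
  have lt_ind : (index x (enum B) < size (enum C))%N.
    by rewrite -cardE -cardBC cardE index_mem mem_enum.
  split=> [|y]; first by rewrite -mem_enum mem_nth.
  by rewrite index_uniq ?enum_uniq // nth_index // mem_enum.
(* Elements of [A] and of its complement are exchanged when they have the same rank in the two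
   enumerations. *)
pose s x := if x \in A then nth x (enum (~: A)) (index x (enum A))
            else nth x (enum A) (index x (enum (~: A))).
exists s => x; rewrite /s; case: (boolP (x \in A)) => [xA|].
- have [] := swap A (~: A) x cardA xA.
  by rewrite inE => /negbTE -> ->.
- rewrite -in_setC => xA.
  by have [-> ->] := swap (~: A) A x (esym cardA) xA.
- have [] := swap A (~: A) x cardA xA.
  by rewrite inE => /negbTE ->.
- rewrite -in_setC => xA.
  by have [->] := swap (~: A) A x (esym cardA) xA.
Qed.

Lemma col_mulmx (R : pzSemiRingType) m n p (A : 'M[R]_(m, n))
    (B : 'M[R]_(n, p)) j :
  col j (A *m B) = A *m col j B.
Proof. by rewrite !colE mulmxA. Qed.

(** * Calculus of conjugate transposes, [H]-adjoints and the form *)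

Section Factorization.
Variables (K : numFieldType) (conj : {rmorphism K -> K}).
Hypothesis conj_involutive : involutive conj.

Local Notation ct := (conj_transpose conj).

Lemma conj_transposeM m n p (A : 'M[K]_(m, n)) (B : 'M[K]_(n, p)) :
  ct (A *m B) = ct B *m ct A.
Proof. by rewrite /conj_transpose trmx_mul map_mxM. Qed.

Lemma conj_transposeK m n (A : 'M[K]_(m, n)) : ct (ct A) = A.
Proof. by apply/matrixP=> i j; rewrite !mxE conj_involutive. Qed.

Lemma conj_transposeD m n (A B : 'M[K]_(m, n)) : ct (A + B) = ct A + ct B.
Proof. by apply/matrixP=> i j; rewrite !mxE rmorphD. Qed.

Lemma conj_transposeN m n (A : 'M[K]_(m, n)) : ct (- A) = - ct A.
Proof. by apply/matrixP=> i j; rewrite !mxE rmorphN. Qed.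

Lemma conj_transpose1 n : ct (1%:M : 'M[K]_n) = 1%:M.
Proof. by rewrite /conj_transpose trmx1 map_mx1. Qed.

Section Form.
Variables (n : nat) (H : 'M[K]_n).
Hypotheses (H_unit : H \in unitmx) (H_sa : selfadjoint conj H).

Local Notation hadj := (hadjoint conj H).
Local Notation form := (hform conj H).

Lemma mul_hadjoint A : H *m hadj A = ct A *m H.
Proof. by rewrite /hadjoint !mulmxA mulmxV // mul1mx. Qed.

Lemma hadjoint_eq A B : ct A *m H = H *m B -> hadj A = B.
Proof.
by move=> eqAB; rewrite /hadjoint -mulmxA eqAB mulmxA mulVmx // mul1mx.
Qed.

Lemma hadjointM A B : hadj (A *m B) = hadj B *m hadj A.
Proof.
apply: hadjoint_eq.
by rewrite mulmxA mul_hadjoint -mulmxA mul_hadjoint conj_transposeM mulmxA.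
Qed.

Lemma hadjointD A B : hadj (A + B) = hadj A + hadj B.
Proof. by rewrite /hadjoint conj_transposeD mulmxDr mulmxDl. Qed.

Lemma hadjointN A : hadj (- A) = - hadj A.
Proof. by rewrite /hadjoint conj_transposeN mulmxN mulNmx. Qed.

Lemma hadjoint1 : hadj 1%:M = 1%:M.
Proof. by apply: hadjoint_eq; rewrite conj_transpose1 mul1mx mulmx1. Qed.

Lemma hform_mul A (v w : 'cV[K]_n) : form (A *m v) w = form v (hadj A *m w).
Proof.
rewrite /hform conj_transposeM; congr (fun_of_matrix _ _ _).
by rewrite -mulmxA mulmxA -(mulmxA _ H (hadj A *m w)) (mulmxA H) mul_hadjoint
  !mulmxA.
Qed.

Lemma conj_hform (v w : 'cV[K]_n) : conj (form v w) = form w v.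
Proof.
have -> : form w v = ct (ct v *m H *m w) 0 0.
  by rewrite !conj_transposeM H_sa conj_transposeK /hform mulmxA.
by rewrite /conj_transpose mxE [in RHS]mxE.
Qed.

Lemma hformNl (v w : 'cV[K]_n) : form (- v) w = - form v w.
Proof. by rewrite /hform conj_transposeN !mulNmx mxE. Qed.

Lemma hformNr (v w : 'cV[K]_n) : form v (- w) = - form v w.
Proof. by rewrite /hform mulmxN mxE. Qed.

Lemma gram_coef m (B : 'M[K]_(n, m)) i j :
  (ct B *m H *m B) i j = form (col i B) (col j B).
Proof.
rewrite /hform !mxE; apply: eq_bigr => k _; rewrite !mxE; congr (_ * _).
by apply: eq_bigr => l _; rewrite !mxE.
Qed.

(** * Involutions built from a skew [S] with [S^3 = S] *)

Definition skew_involution (S : 'M[K]_n) : 'M[K]_n := 1%:M - S *m S + S.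

Section Skew.
Variables (S : 'M[K]_n).
Hypotheses (S_skew : hadj S = - S) (S_cube : S *m S *m S = S).

(** Put [P = 1 - S^2]. From [S^3 = S] follow [P^2 = P] and [P S = S P = 0], so the cross terms
    vanish. The choice [A = S] gives [X^2 = 1], and [A = - S] gives [X X^* = 1 - 2 S^2]. *)
Lemma skew_involutionM A : A = S \/ A = - S ->
  skew_involution S *m (1%:M - S *m S + A) = 1%:M - S *m S + S *m A.
Proof.
have PP : (1%:M - S *m S) *m (1%:M - S *m S) = 1%:M - S *m S.
  by rewrite mulmxBr mulmx1 mulmxBl mul1mx mulmxA S_cube subrr subr0.
have SP : S *m (1%:M - S *m S) = 0.
  by rewrite mulmxBr mulmx1 mulmxA S_cube subrr.
have PS : (1%:M - S *m S) *m S = 0 by rewrite mulmxBl mul1mx S_cube subrr.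
move=> AE; have PA : (1%:M - S *m S) *m A = 0.
  by case: AE => ->; rewrite ?mulmxN PS ?oppr0.
rewrite /skew_involution mulmxDl.
by rewrite [_ *m (_ + A) in X in X + _]mulmxDr [S *m (_ + A)]mulmxDr PP SP
  PA addr0 add0r.
Qed.

Lemma skew_involutionK : involutory (skew_involution S).
Proof. by rewrite /involutory skew_involutionM; [rewrite subrK | left]. Qed.

Lemma hadjoint_skew_involution :
  hadj (skew_involution S) = skew_involution (- S).
Proof.
by rewrite /skew_involution !hadjointD hadjointN hadjointM hadjoint1 S_skew.
Qed.

Lemma skew_involution_hadjoint :
  skew_involution S *m hadj (skew_involution S) = 1%:M - (S *m S) *+ 2.
Proof.
rewrite hadjoint_skew_involution /skew_involution mulNmx !mulmxN opprK.
by rewrite skew_involutionM; [rewrite mulmxN mulr2n opprD addrA | right].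
Qed.
End Skew.

Lemma skew_factorization Phi W S :
  hadj S = - S -> S *m S *m S = S -> Phi = 1%:M - (S *m S) *+ 2 ->
  hadj W *m W = Phi ->
  hfactorization conj H W (W *m skew_involution S) (skew_involution S).
Proof.
move=> S_skew S_cube PhiE WW; set X := skew_involution S.
have NS_skew : hadj (- S) = - - S by rewrite hadjointN S_skew.
have NS_cube : - S *m - S *m - S = - S by rewrite mulNmx !mulmxN opprK S_cube.
have XX : X *m X = 1%:M by exact: skew_involutionK.
have XXa : X *m hadj X = Phi by rewrite skew_involution_hadjoint.
(* [X^*] is the involution built from [- S], with adjoint [X], so the formula for [X X^*] applied to
   [- S] computes [X^* X]. *)
have XaX : hadj X *m X = Phi.
  have := skew_involution_hadjoint NS_skew NS_cube.
  rewrite (hadjoint_skew_involution NS_skew) opprK.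
  by rewrite -(hadjoint_skew_involution S_skew) mulNmx mulmxN opprK -PhiE.
have LL : hadj (W *m X) *m (W *m X) = 1%:M.
  (* Since [W^* W = X^* X], the product becomes [(X X)^* (X X)]. *)
  rewrite hadjointM -mulmxA (mulmxA (hadj W)) WW -XaX -mulmxA XX mulmx1.
  by rewrite -hadjointM XX hadjoint1.
split; first by rewrite -mulmxA XX mulmx1.
  by split; last exact: mulmx1C.
split=> //; last by rewrite /hnormal XXa XaX.
left=> u v /mem_neg_eigenspace Xu /mem_neg_eigenspace Xv.
(* When [X v = - v], the identity [S^2 X = S] gives [S v = - S^2 v], hence [X v = Phi v]. *)
have SSX : S *m S *m X = S.
  by rewrite mulmxDr mulmxBr mulmx1 !mulmxA !S_cube subrr add0r.
have SSv : S *m v = - (S *m S *m v) by rewrite -{1}SSX -mulmxA Xv mulmxN.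
have Phiv : Phi *m v = - v.
  rewrite -Xv PhiE /X /skew_involution mulr2n !(mulmxDl, mulNmx).
  by rewrite SSv opprD addrA.
(* [[u, v] = [X u, X v] = [u, X^* X v] = [u, Phi v] = - [u, v]], in characteristic zero. *)
apply/eqP; rewrite -[_ == 0](mulrn_eq0 _ 2) mulr2n addr_eq0 -hformNr.
by rewrite -Phiv -XaX -mulmxA -hform_mul Xu Xv hformNr hformNl opprK.
Qed.

(** * A skew square root of the projection onto the negative eigenspace *)

Hypothesis conj_real : forall x, (x \is Num.real) = (conj x == x).
Hypothesis sqrt_ex : forall x : K, 0 <= x -> exists2 r, 0 <= r & r * r = x.

(* M permutes the coordinates by an involution matching the positive entries
   of g with the negative ones; its coefficients are
   [+/- 1 / sqrt (- g j * g (s j))]. *)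
Lemma skew_diag_root m (g : 'rV[K]_m) :
  (forall i, g 0 i \is Num.real) -> (forall i, g 0 i != 0) ->
  #|[set i | 0 < g 0 i]| = #|[set i | g 0 i < 0]| ->
  exists2 M : 'M[K]_m, ct M = - M
    & M *m diag_mx g *m (M *m diag_mx g) = 1%:M.
Proof.
move=> g_real g_neq0 card_g.
have negE : [set i | g 0 i < 0] = ~: [set i | 0 < g 0 i].
  by apply/setP=> i; rewrite !inE -real_leNgt ?real0 // le_eqVlt
    (negbTE (g_neq0 i)).
rewrite negE in card_g; have [s s_inv sP] := half_set_involution card_g.
have {}sP i : (0 < g 0 (s i)) = (g 0 i < 0).
  by move: (sP i); rewrite -in_setC -negE !inE.
have sN i : (g 0 (s i) < 0) = (0 < g 0 i) by rewrite -sP s_inv.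
have gg_lt0 i : g 0 i * g 0 (s i) < 0.
  have := g_neq0 i; rewrite real_neqr_lt ?real0 // => /orP[gi|gi].
    by rewrite nmulr_rlt0 // sP.
  by rewrite pmulr_rlt0 // sN.
have [r r_ge0 rE] : exists2 r : 'I_m -> K, forall i, 0 <= r i
    & forall i, r i * r i = - (g 0 i * g 0 (s i)).
  have ex i : exists r, (0 <= r) && (r * r == - (g 0 i * g 0 (s i))).
    have [|r r0 rr] := @sqrt_ex (- (g 0 i * g 0 (s i))).
      by rewrite oppr_ge0 ltW.
    by exists r; rewrite r0 rr /=.
  exists (fun i => xchoose (ex i)) => i; have /andP[] := xchooseP (ex i) => //.
  by move=> _ /eqP.
have rs i : r (s i) = r i.
  by apply/eqP; rewrite -(eqrXn2 (n := 2)) // !expr2 !rE s_inv mulrC.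
(* The sign makes [c] odd under [s], whence [M] is skew; the size gives
   [c i ^ 2 = - 1 / (g i * g (s i))]. *)
pose c i := if 0 < g 0 i then (r i)^-1 else - (r i)^-1.
have cs i : c (s i) = - c i.
  have := g_neq0 i; rewrite /c sP rs real_neqr_lt ?real0 // => /orP[gi|gi].
    by rewrite gi (lt_gtF gi) /= opprK.
  by rewrite gi (lt_gtF gi).
have conj_c i : conj (c i) = c i.
  by apply/eqP; rewrite -conj_real /c; case: ifP;
    rewrite ?realN realV ger0_real.
have cc i : c i * c i = - (g 0 i * g 0 (s i))^-1.
  by rewrite -invrN -rE invfM /c; case: ifP; rewrite ?mulrNN.
exists (\matrix_(i, j) (c j *+ (i == s j))).
  apply/matrixP=> i j; rewrite !mxE rmorphMn conj_c eq_sym.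
  rewrite (can2_eq s_inv s_inv).
  by case: eqP => [->|]; rewrite ?cs ?mulr0n ?oppr0.
(* Only [k = s j] contributes, and a diagonal entry is [c (s j) * g (s j) * c j * g j = 1]. *)
apply/matrixP=> i j; rewrite mul_mx_diag !mxE (bigD1 (s j)) //= big1 => [|k].
  rewrite !mxE eqxx s_inv addr0 cs; case: eqP => _; last by rewrite !mul0r.
  by rewrite !mulr1n mulrACA mulNr cc opprK mulrC
    [g 0 (s j) * _]mulrC divff ?lt_eqF.
by rewrite !mxE => /negbTE ->; rewrite mul0r mulr0.
Qed.

Lemma skew_root Phi :
  hselfadjoint conj H Phi -> involutory Phi ->
  hyperbolic conj H (neg_eigenspace Phi) ->
  exists S, [/\ hadj S = - S, S *m S *m S = S & Phi = 1%:M - (S *m S) *+ 2].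
Proof.
move=> Phi_sa PhiK [nondeg [p [b [b_basis b_orth cardP cardN]]]].
set N := neg_eigenspace Phi in b b_basis b_orth cardP cardN nondeg.
pose g := \row_i form (tnth b i) (tnth b i).
pose B := \matrix_(i, j) tnth b j i 0.
have colB j : col j B = tnth b j.
  by apply/matrixP=> i k; rewrite !mxE ord1.
have memN v : v \in N -> exists y, v = B *m y.
  move=> vN; exists (\col_i coord b i v).
  rewrite [LHS](coord_basis b_basis vN); apply/matrixP=> i k.
  rewrite summxE !mxE.
  by apply: eq_bigr => j _; rewrite !mxE (tnth_nth 0) ord1 mulrC.
have bN i : tnth b i \in N by rewrite (basis_mem b_basis) // mem_tnth.
have gramB : ct B *m H *m B = diag_mx g.
  apply/matrixP=> i j; rewrite gram_coef !colB !mxE.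
  by case: eqVneq => [->|/b_orth].
have g_real i : g 0 i \is Num.real by rewrite conj_real mxE conj_hform.
(* An isotropic vector of the orthogonal basis would be orthogonal to all of [N]. *)
have g_neq0 i : g 0 i != 0.
  apply/eqP=> gi0; have /negP[] : tnth b i != 0.
    by rewrite (free_not0 (basis_free b_basis)) // mem_tnth.
  apply/eqP/nondeg => // v /memN[y ->].
  rewrite /hform mulmxA.
  suff -> : ct (tnth b i) *m H *m B = 0 by rewrite mul0mx mxE.
  apply/matrixP=> k j; rewrite ord1 [RHS]mxE.
  have <- : form (tnth b i) (tnth b j) = 0.
    by case: (eqVneq i j) => [<-|/b_orth //]; rewrite -gi0 mxE.
  by rewrite -(colB j) /hform -col_mulmx [RHS]mxE.
have [|||M M_skew MgMg] := skew_diag_root (g := g).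
- by [].
- by [].
- have -> : [set i | 0 < g 0 i] = [set i | 0 < form (tnth b i) (tnth b i)].
    by apply/setP=> i; rewrite !inE mxE.
  have -> : [set i | g 0 i < 0] = [set i | form (tnth b i) (tnth b i) < 0].
    by apply/setP=> i; rewrite !inE mxE.
  by rewrite cardP cardN.
(* In the basis [B] of [N], [S] acts as [M *m diag_mx g], and the factor [ct B *m H] kills the
   orthogonal complement of [N]. *)
have [S SE] : exists S, S = B *m M *m ct B *m H by exists (B *m M *m ct B *m H).
have SB : S *m B = B *m (M *m diag_mx g).
  by rewrite SE -!mulmxA (mulmxA (ct B)) gramB.
have SSB : S *m S *m B = B.
  by rewrite -mulmxA SB mulmxA SB -mulmxA MgMg mulmx1.
exists S; split.
- by apply: hadjoint_eq; rewrite SE !conj_transposeM conj_transposeK M_skew H_sa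
    mulNmx !mulmxN mulNmx !mulmxA.
- by rewrite {3}SE !mulmxA SSB -SE.
have PhiB : Phi *m B = - B.
  apply/matrixP => i j; have /mem_neg_eigenspace := bN j; rewrite -colB.
  rewrite -col_mulmx => /matrixP/(_ i 0).
  by rewrite !mxE.
(* [Phi (1 - Phi) = - (1 - Phi)], so the columns of [1 - Phi] lie in [N], where [S^2] is the
   identity. *)
have [Y ZE] : exists Y, 1%:M - Phi = B *m Y.
  have ex j : exists y : 'cV_(\dim N), col j (1%:M - Phi) == B *m y.
    have [|y ->] := memN (col j (1%:M - Phi)); last by exists y.
    apply/mem_neg_eigenspace; rewrite -col_mulmx mulmxBr mulmx1 PhiK.
    by rewrite -linearN opprB.
  exists (\matrix_(i, j) xchoose (ex j) i 0); apply/matrixP=> i j.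
  have /eqP/matrixP/(_ i 0) := xchooseP (ex j); rewrite 2!mxE => ->.
  by rewrite !mxE; apply: eq_bigr => k _; rewrite !mxE.
have SSZ : S *m S *m (1%:M - Phi) = 1%:M - Phi by rewrite ZE mulmxA SSB.
have SPhi : S *m Phi = - S.
  rewrite SE -mulmxA -[in H *m Phi]Phi_sa mul_hadjoint !mulmxA.
  by rewrite -(mulmxA _ (ct B)) -conj_transposeM PhiB conj_transposeN
    mulmxN mulNmx.
(* [S Phi = - S] turns [S^2 (1 - Phi) = 1 - Phi] into [2 S^2 = 1 - Phi]. *)
move: SSZ; rewrite mulr2n mulmxBr mulmx1 -mulmxA SPhi mulmxN opprK => ->.
by rewrite opprB addrC subrK.
Qed.

(** The factorizations come from [S] and [- S]. Equal right factors force [S = - S], hence [S = 0]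
    and [Phi = 1]. *)
Lemma two_factorizations Phi W :
  hselfadjoint conj H Phi -> involutory Phi ->
  hyperbolic conj H (neg_eigenspace Phi) ->
  unitary_between conj H (H *m Phi) W ->
  exists L X L' X' : 'M[K]_n,
    [/\ hfactorization conj H W L X, hfactorization conj H W L' X'
      & Phi <> 1%:M -> (L, X) <> (L', X')].
Proof.
move=> Phi_sa PhiK Phi_hyp W_unit.
have [S [S_skew S_cube PhiE]] := skew_root Phi_sa PhiK Phi_hyp.
have WW : hadj W *m W = Phi.
  by rewrite /hadjoint -!mulmxA (mulmxA (ct W)) W_unit mulmxA mulVmx // mul1mx.
exists (W *m skew_involution S), (skew_involution S).
exists (W *m skew_involution (- S)), (skew_involution (- S)).
split; [exact: (skew_factorization (Phi := Phi)) | |].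
  apply: (skew_factorization (Phi := Phi)) => //.
  - by rewrite hadjointN S_skew.
  - by rewrite mulNmx !mulmxN opprK S_cube.
  - by rewrite mulNmx mulmxN opprK.
move=> Phi_neq1 [_]; rewrite /skew_involution mulNmx mulmxN opprK => /addrI SN.
apply: Phi_neq1; rewrite PhiE.
suff -> : S = 0 by rewrite mul0mx mul0rn subr0.
apply/matrixP=> i j; move/matrixP/(_ i j): SN; rewrite !mxE => /eqP.
by rewrite -addr_eq0 -mulr2n mulrn_eq0 => /eqP.
Qed.

End Form.
End Factorization.

Unset Implicit Arguments.

Theorem theorem5p4 (R : realType) (K : numFieldType) (conj : K -> K)
    (hK : real_or_complex R conj) (n : nat) (H Phi : 'M[K]_n)
    (H_nonsingular : H \in unitmx) (H_selfadjoint : selfadjoint conj H)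
    (Phi_hselfadjoint : hselfadjoint conj H Phi)
    (Phi_involutory : involutory Phi)
    (Phi_hyperbolic : hyperbolic conj H (neg_eigenspace Phi))
    (W : 'M[K]_n) (W_unitary : unitary_between conj H (H *m Phi) W) :
  (exists L X : 'M[K]_n, hfactorization conj H W L X)
  /\ (Phi <> 1%:M ->
      exists L X L' X' : 'M[K]_n,
        [/\ hfactorization conj H W L X, hfactorization conj H W L' X'
          & (L, X) <> (L', X')]).
Proof.
suff [L [X [L' [X' [LX LX' neq]]]]] : exists L X L' X' : 'M[K]_n,
    [/\ hfactorization conj H W L X, hfactorization conj H W L' X'
      & Phi <> 1%:M -> (L, X) <> (L', X')].
  split=> [|/neq Phi_neq1]; first by exists L, X.
  by exists L, X, L', X'.
(* In both cases the fixed points of [conj] are the real elements and nonnegative elements have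
   nonnegative square roots. *)
case: K conj / hK H Phi H_nonsingular H_selfadjoint Phi_hselfadjoint
  Phi_involutory Phi_hyperbolic W W_unitary
  => H Phi H_unit H_sa Phi_sa PhiK Phi_hyp W W_unitary.
- apply: (@two_factorizations R idfun) => // [x|x x_ge0].
    by rewrite num_real eqxx.
  by exists (Num.sqrt x); rewrite ?sqrtr_ge0 // -expr2 sqr_sqrtr.
- apply: (@two_factorizations R[i] Num.conj) => // [|x|x x_ge0].
  + exact: conjCK.
  + by rewrite CrealE.
  + by exists (sqrtC x); rewrite ?sqrtC_ge0 // -expr2 sqrtCK.
Qed.
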